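(* Let $S$ be a smooth surface and let $\phi:S\to Q$ be a totally isotropic immersion. If $\phi_+:S\to Q$ is an immersion, then $\phi_{++}=\phi_-$ and $\phi_{+-}=\phi$. Likewise, if $\phi_-:S\to Q$ is an immersion, then $\phi_{--}=\phi_+$ and $\phi_{-+}=\phi$. (Here $\phi_{+\pm}=(\phi_+)_\pm$ and $\phi_{-\pm}=(\phi_-)_\pm$.)
   Context: Zorn matrices. Let $\mathcal{Z}$ be the real algebra of matrices $\begin{pmatrix} a & x \\ y & b \end{pmatrix}$, $a,b\in\mathbb{R}$, $x,y\in\mathbb{R}^3$, with product $$\begin{pmatrix} a & x \\ y & b \end{pmatrix}\begin{pmatrix} a' & x' \\ y' & b' \end{pmatrix}=\begin{pmatrix} aa'+x\cdot y' & ax'+b'x-y\times y' \\ a'y+by'+x\times x' & x'\cdot y+bb' \end{pmatrix}$$ and multiplicative norm $N=ab-x\cdot y$ of signature $(4,4)$; it is a split octonion algebra. $L_Z,R_Z$ denote left and right multiplication by $Z$. For $Z\neq0$ with $N(Z)=0$, $\ker L_Z$ and $\ker R_Z$ are maximal (4-dimensional) totally isotropic subspaces; each maximal totally isotropic subspace is of exactly one of these two forms, with $Z$ unique up to scalar, and each 3-dimensional totally isotropic subspace is contained in exactly one of each form. Quadric. $\mathbb{R}^{4,4}=\mathbb{R}^3\times\mathbb{R}\times\mathbb{R}^3\times\mathbb{R}$ carries $q(x,s,y,t)=x\cdot y+st$, and $Q=\{(x:s:y:t): x\cdot y+st=0\}\subset P(\mathbb{R}^{4,4})=\mathbb{R}P^7$.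 The linear isomorphism $\rho:\mathbb{R}^{4,4}\to\mathcal{Z}$, $\rho(x,s,y,t)=\begin{pmatrix} s & x \\ y & -t \end{pmatrix}$, satisfies $N\circ\rho=-q$ and identifies $Q$ with the quadric of isotropic lines of $\mathcal{Z}$. A smooth map $\phi:S\to Q$ is totally isotropic if for every local lift $\psi:S\to\mathbb{R}^{4,4}\setminus\{0\}$ and every $p$, the subspace $V_p=\mathbb{R}\psi(p)+\mathrm{im}\,d\psi(p)$ is totally isotropic; if $\phi$ is an immersion, $\dim V_p=3$. For a totally isotropic immersion $\phi:S\to Q$, the maps $\phi_\pm:S\to Q$ are defined by: $\phi_+(p)\in Q$ is the point such that $\rho(\phi_+(p))=\mathbb{R}Z_+$ with $\ker L_{Z_+}\supset\rho(V_p)$, and $\phi_-(p)\in Q$ is the point such that $\rho(\phi_-(p))=\mathbb{R}Z_-$ with $\ker R_{Z_-}\supset\rho(V_p)$. (This uses the identification of each of the two families $Q_+,Q_-$ of projective 3-spaces contained in $Q$ with $Q$ itself, via $\rho^{-1}(\ker L_{Z_+})\mapsto\rho^{-1}(\mathbb{R}Z_+)$ and $\rho^{-1}(\ker R_{Z_-})\mapsto\rho^{-1}(\mathbb{R}Z_-)$.) The maps $\phi_\pm$ are smooth and totally isotropic. *)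

(* Defs.v *)
From HB Require Import structures.
From mathcomp Require Import all_boot all_order all_algebra.
From mathcomp Require Import all_classical all_reals all_analysis.

Set Implicit Arguments.
Unset Strict Implicit.
Unset Printing Implicit Defensive.

Import Order.TTheory GRing.Theory Num.Theory.
Import numFieldNormedType.Exports.

Local Open Scope classical_set_scope.
Local Open Scope ring_scope.

(* [f] is meaningful on the open set [U] only. In finite dimension, [f] is
   C^(k+1) iff it is differentiable and all its directional derivatives are
   C^k. *)
Fixpoint Ck_on {R : realType} {V W : normedModType R} (k : nat) (U : set V)
    (f : V -> W) : Prop :=
  match k with
  | 0 => forall x, U x -> {for x, continuous f}
  | k'.+1 => (forall x, U x -> differentiable f x) /\
             (forall v, Ck_on k' U ('D_v f))
  end.

Definition smooth_on {R : realType} {V W : normedModType R} (U : set V)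
    (f : V -> W) : Prop :=
  forall k, Ck_on k U f.

(* [fwd] and [bwd] are total functions; they are only meaningful on [dom] and
   on the image [fwd @` dom] respectively. *)
Record chart (R : realType) (S : topologicalType) := Chart {
  dom : set S;
  fwd : S -> 'rV[R]_2;
  bwd : 'rV[R]_2 -> S;
  open_dom : open dom;
  open_codom : open (fwd @` dom);
  fwdK : forall p, dom p -> bwd (fwd p) = p;
  fwd_continuous : {within dom, continuous fwd};
  bwd_continuous : {within fwd @` dom, continuous bwd} }.

(* [chart_at] is an arbitrary choice of a chart of the atlas around each
   point. *)
Record smoothSurface (R : realType) := SmoothSurface {
  carrier :> topologicalType;
  atlas : set (chart R carrier);
  chart_at : carrier -> chart R carrier;
  hausdorff_carrier : hausdorff_space carrier;
  second_countable_carrier : @second_countable carrier;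
  chart_at_atlas : forall p, atlas (chart_at p);
  dom_chart_at : forall p, dom (chart_at p) p;
  transition_smooth : forall c d, atlas c -> atlas d ->
    smooth_on (fwd c @` (dom c `&` dom d)) (fwd d \o bwd c) }.

Arguments atlas {R} S : rename.
Arguments chart_at {R S} p : rename.

Definition surf_smooth_on {R : realType} {S : smoothSurface R}
    {W : normedModType R} (U : set S) (f : S -> W) : Prop :=
  forall c, atlas S c -> smooth_on (fwd c @` (U `&` dom c)) (f \o bwd c).

(* The differential of [f] at [p], the tangent plane of [S] at [p] being
   identified with R^2 by the chart [chart_at p]. *)
Definition surf_diff {R : realType} {S : smoothSurface R}
    {W : normedModType R} (f : S -> W) (p : S) : 'rV[R]_2 -> W :=
  'd (f \o bwd (chart_at p)) (fwd (chart_at p) p).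

Definition dotv {R : realType} (x y : 'rV[R]_3) : R :=
  \sum_(i < 3) x 0 i * y 0 i.

(* The indices [k + 1] and [k + 2] are taken modulo 3. *)
Definition crossv {R : realType} (x y : 'rV[R]_3) : 'rV[R]_3 :=
  \row_(k < 3) (x 0 (k + 1) * y 0 (k + 2%:R) - x 0 (k + 2%:R) * y 0 (k + 1)).

(* [(a, x, y, b)] is the Zorn matrix with first row (a x) and second row
   (y b). *)
Definition zorn (R : realType) : Type :=
  (R^o * 'rV[R]_3 * 'rV[R]_3 * R^o)%type.

Definition zmul {R : realType} (Z W : zorn R) : zorn R :=
  let: (a, x, y, b) := Z in
  let: (a', x', y', b') := W in
  (a * a' + dotv x y',
   a *: x' + b' *: x - crossv y y',
   a' *: y + b *: y' + crossv x x',
   dotv x' y + b * b').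

Definition kerL {R : realType} (Z : zorn R) : set (zorn R) :=
  [set W | zmul Z W = 0].

Definition kerR {R : realType} (Z : zorn R) : set (zorn R) :=
  [set W | zmul W Z = 0].

Definition R44 (R : realType) : Type :=
  ('rV[R]_3 * R^o * 'rV[R]_3 * R^o)%type.

Definition q44 {R : realType} (v : R44 R) : R :=
  let: (x, s, y, t) := v in dotv x y + s * t.

Definition rho {R : realType} (v : R44 R) : zorn R :=
  let: (x, s, y, t) := v in (s, x, y, - t).

Definition isotropic {R : realType} (V : set (R44 R)) : Prop :=
  forall v, V v -> q44 v = 0.

Definition isotropic_line {R : realType} (l : {vspace R44 R}) : bool :=
  (\dim l == 1)%N && `[< isotropic [set` l] >].

(* A point of the projective space is a line in R^(4,4). *)
Definition quadric (R : realType) : Type :=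
  {l : {vspace R44 R} | isotropic_line l}.

Lemma quadric0_subproof (R : realType) :
  isotropic_line <[((0, 1, 0, 0) : R44 R)%R]>%VS.
Proof.
apply/andP; split.
  rewrite dim_vline eqb1; apply/eqP => -[] /eqP.
  by rewrite oner_eq0.
apply/asboolP => v /= /vlineP[k ->] /=.
rewrite !scaler0 mulr0 addr0 /dotv big1// => i _; by rewrite mxE mul0r.
Qed.

Definition quadric0 (R : realType) : quadric R :=
  exist isotropic_line _ (quadric0_subproof R).

(* The affine chart of the projective space attached to a linear form [lam]:
   a line on which [lam] is nonzero is sent to its vector in the affine
   hyperplane [lam = 1]. *)
Definition affine_chart {R : realType} (lam : {scalar R44 R})
    (z : quadric R) : R44 R :=
  (lam (vpick (val z)))^-1 *: vpick (val z).

Definition in_affine_chart {R : realType} (lam : {scalar R44 R})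
    (z : quadric R) : Prop :=
  lam (vpick (val z)) != 0.

(* As the quadric is an embedded submanifold of the projective space,
   smoothness and immersivity of a map into it are those of the map into the
   projective space. *)
Definition smooth_map {R : realType} {S : smoothSurface R}
    (phi : S -> quadric R) : Prop :=
  forall (p : S) (lam : {scalar R44 R}), in_affine_chart lam (phi p) ->
  exists U : set S, [/\ open U, U p,
    forall u, U u -> in_affine_chart lam (phi u) &
    surf_smooth_on U (affine_chart lam \o phi)].

Definition immersion {R : realType} {S : smoothSurface R}
    (phi : S -> quadric R) : Prop :=
  smooth_map phi /\
  forall (p : S) (lam : {scalar R44 R}), in_affine_chart lam (phi p) ->
  injective (surf_diff (affine_chart lam \o phi) p).

Definition local_lift {R : realType} {S : smoothSurface R}
    (phi : S -> quadric R) (U : set S) (psi : S -> R44 R) : Prop :=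
  [/\ open U, surf_smooth_on U psi &
      forall u, U u -> psi u != 0 /\ psi u \in val (phi u)].

(* R psi(p) + im d psi(p) *)
Definition lift_span {R : realType} {S : smoothSurface R}
    (psi : S -> R44 R) (p : S) : set (R44 R) :=
  [set w | exists (a : R) (v : 'rV[R]_2), w = a *: psi p + surf_diff psi p v].

Definition totally_isotropic {R : realType} {S : smoothSurface R}
    (phi : S -> quadric R) : Prop :=
  forall (U : set S) (psi : S -> R44 R), local_lift phi U psi ->
  forall p, U p -> isotropic (lift_span psi p).

(* The space V_p; [lift_span psi p] is the same for all local lifts [psi] of
   [phi] near [p]. *)
Definition span_at {R : realType} {S : smoothSurface R}
    (phi : S -> quadric R) (p : S) : set (R44 R) :=
  [set w | exists (U : set S) (psi : S -> R44 R),
    [/\ local_lift phi U psi, U p & lift_span psi p w]].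

Definition is_plus_point {R : realType} {S : smoothSurface R}
    (phi : S -> quadric R) (p : S) (z : quadric R) : Prop :=
  exists Z : zorn R, rho @` [set` val z] = [set` <[Z]>%VS] /\
                     rho @` span_at phi p `<=` kerL Z.

Definition is_minus_point {R : realType} {S : smoothSurface R}
    (phi : S -> quadric R) (p : S) (z : quadric R) : Prop :=
  exists Z : zorn R, rho @` [set` val z] = [set` <[Z]>%VS] /\
                     rho @` span_at phi p `<=` kerR Z.

(* For a totally isotropic immersion [phi], there is exactly one [z] such that
   [is_plus_point phi p z], and likewise for [is_minus_point]. In the other
   cases, the arbitrary point [quadric0] may be returned. *)
Definition phi_plus {R : realType} {S : smoothSurface R}
    (phi : S -> quadric R) : S -> quadric R :=
  fun p => xget (quadric0 R) (is_plus_point phi p).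

Definition phi_minus {R : realType} {S : smoothSurface R}
    (phi : S -> quadric R) : S -> quadric R :=
  fun p => xget (quadric0 R) (is_minus_point phi p).

(* Main.v *)
Require Import Defs.
From HB Require Import structures.
From mathcomp Require Import all_boot all_order all_algebra.
From mathcomp Require Import all_classical all_reals all_analysis.
From mathcomp Require Import ring lra.

(* Write [x y] for the split octonion product. Along a lift f of phi and a lift
   g of phi_+ we have g f = 0 and g df = 0; differentiating gives dg f = 0, so
   phi is the minus point of phi_+, and d_i g d_j f = - g d_i d_j f is symmetric
   in i and j. Let w span phi_-, so that f w = 0 and df w = 0. By a Moufang
   identity, f w = 0 and a f = 0 force w a to be a multiple of the conjugate of
   f. For a = g this also holds with d_1 f for f, so w g = 0. For a = d_i g it
   gives scalars c_i with w (d_i g) = c_i f', f' being the conjugate of f. A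
   second use of the Moufang identity turns the symmetry of d_i g d_j f into a
   linear relation between f, d_1 f and d_2 f whose coefficients on the last two
   are - c_2 and c_1. Hence w dg = 0, and w spans phi_++. Exchanging the two
   sides of the product gives the second half.

   The product is transported to R^(4,4) by rho, where the norm becomes - q. *)

Set Implicit Arguments.
Unset Strict Implicit.
Unset Printing Implicit Defensive.

Import Order.TTheory GRing.Theory Num.Theory.
Import numFieldNormedType.Exports.

Local Open Scope classical_set_scope.
Local Open Scope ring_scope.

(** * Coordinates on R^(4,4) and identities of the split octonion product *)

Section Algebra.
Context {R : realType}.
Implicit Types (a b c x y z u v w : R44 R) (op : bool).

Definition row3 (a b c : R) : 'rV[R]_3 := \row_k [:: a; b; c]`_k.

(** With all eight scalar coordinates in the open, polynomial identities between vectors split into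
    scalar ones that [ring] decides. *)
Definition mk (p1 p2 p3 s r1 r2 r3 t : R) : R44 R :=
  (row3 p1 p2 p3, s : R^o, row3 r1 r2 r3, t : R^o).

Lemma row3K (x : 'rV[R]_3) : x = row3 (x 0 0) (x 0 1) (x 0 2%:R).
Proof.
apply/rowP => -[[|[|[|m]]] i3] //; rewrite mxE /=; congr (x _ _); exact/val_inj.
Qed.

Lemma mkP x : exists p1 p2 p3 s r1 r2 r3 t, x = mk p1 p2 p3 s r1 r2 r3 t.
Proof.
move: x => [[[x s] y] t].
exists (x 0 0), (x 0 1), (x 0 2%:R), s, (y 0 0), (y 0 1), (y 0 2%:R), t.
by rewrite /mk -!row3K.
Qed.

Definition rhoV (Z : zorn R) : R44 R :=
  let: (a, x, y, b) := Z in (x, a, y, - b).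

(* For [op = true] this is the opposite product, which exchanges [kerL] and
   [kerR]. *)
Definition omul op x y : R44 R :=
  rhoV (if op then zmul (rho y) (rho x) else zmul (rho x) (rho y)).

(** Octonion conjugation seen through [rho]: it swaps the diagonal entries of a Zorn matrix and
    negates the off-diagonal ones. *)
Definition cj x : R44 R :=
  let: (x, s, y, t) := x in (- x, - t, - y, - s).

(** The polar form of [q44]. The norm is [- q44] under [rho], so its polar form is [- bf]; hence the
    signs in the identities below. *)
Definition bf u v : R :=
  let: (x, s, y, t) := u in let: (x', s', y', t') := v in
  dotv x y' + dotv x' y + s * t' + s' * t.

Lemma rhoK : cancel (@rho R) rhoV.
Proof. by move=> [[[x s] y] t] /=; rewrite opprK. Qed.

Lemma rhoVK : cancel rhoV (@rho R).
Proof. by move=> [[[x s] y] t] /=; rewrite opprK. Qed.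

Lemma dotv_row3 (a b c a' b' c' : R) :
  dotv (row3 a b c) (row3 a' b' c') = a * a' + b * b' + c * c'.
Proof. by rewrite /dotv !big_ord_recr big_ord0 /= !mxE /= add0r. Qed.

Lemma crossv_row3 (a b c a' b' c' : R) :
  crossv (row3 a b c) (row3 a' b' c') =
  row3 (b * c' - c * b') (c * a' - a * c') (a * b' - b * a').
Proof. by apply/rowP => -[[|[|[|m]]] i3] //; rewrite !mxE. Qed.

Lemma row3D (a b c a' b' c' : R) :
  row3 a b c + row3 a' b' c' = row3 (a + a') (b + b') (c + c').
Proof. by apply/rowP => -[[|[|[|m]]] i3] //; rewrite !mxE. Qed.

Lemma row3N (a b c : R) : - row3 a b c = row3 (- a) (- b) (- c).
Proof. by apply/rowP => -[[|[|[|m]]] i3] //; rewrite !mxE. Qed.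

Lemma row3Z k (a b c : R) : k *: row3 a b c = row3 (k * a) (k * b) (k * c).
Proof. by apply/rowP => -[[|[|[|m]]] i3] //; rewrite !mxE. Qed.

Definition row3E := (row3D, row3N, row3Z, crossv_row3, dotv_row3).

Lemma mk_add p1 p2 p3 s r1 r2 r3 t p1' p2' p3' s' r1' r2' r3' t' :
  mk p1 p2 p3 s r1 r2 r3 t + mk p1' p2' p3' s' r1' r2' r3' t' =
  mk (p1 + p1') (p2 + p2') (p3 + p3') (s + s')
     (r1 + r1') (r2 + r2') (r3 + r3') (t + t').
Proof. by rewrite /mk -!row3D. Qed.

Lemma mk_opp p1 p2 p3 s r1 r2 r3 t :
  - mk p1 p2 p3 s r1 r2 r3 t =
  mk (- p1) (- p2) (- p3) (- s) (- r1) (- r2) (- r3) (- t).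
Proof. by rewrite /mk -!row3N. Qed.

Lemma mk_scale k p1 p2 p3 s r1 r2 r3 t :
  k *: mk p1 p2 p3 s r1 r2 r3 t =
  mk (k * p1) (k * p2) (k * p3) (k * s) (k * r1) (k * r2) (k * r3) (k * t).
Proof. by rewrite /mk -!row3Z. Qed.

Lemma mk0 : 0 = mk 0 0 0 0 0 0 0 0.
Proof.
have row30 : row3 0 0 0 = 0.
  by apply/rowP => -[[|[|[|m]]] i3] //; rewrite !mxE.
by rewrite /mk row30.
Qed.

Lemma mk_cj p1 p2 p3 s r1 r2 r3 t :
  cj (mk p1 p2 p3 s r1 r2 r3 t) =
  mk (- p1) (- p2) (- p3) (- t) (- r1) (- r2) (- r3) (- s).
Proof. by rewrite /mk -!row3N. Qed.

Lemma mk_bf p1 p2 p3 s r1 r2 r3 t p1' p2' p3' s' r1' r2' r3' t' :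
  bf (mk p1 p2 p3 s r1 r2 r3 t) (mk p1' p2' p3' s' r1' r2' r3' t') =
  p1 * r1' + p2 * r2' + p3 * r3' + (p1' * r1 + p2' * r2 + p3' * r3) +
  s * t' + s' * t.
Proof. by rewrite /= !row3E. Qed.

Lemma mk_mulF p1 p2 p3 s r1 r2 r3 t p1' p2' p3' s' r1' r2' r3' t' :
  omul false (mk p1 p2 p3 s r1 r2 r3 t) (mk p1' p2' p3' s' r1' r2' r3' t') =
  mk (s * p1' - t' * p1 - (r2 * r3' - r3 * r2'))
     (s * p2' - t' * p2 - (r3 * r1' - r1 * r3'))
     (s * p3' - t' * p3 - (r1 * r2' - r2 * r1'))
     (s * s' + (p1 * r1' + p2 * r2' + p3 * r3'))
     (s' * r1 - t * r1' + (p2 * p3' - p3 * p2'))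
     (s' * r2 - t * r2' + (p3 * p1' - p1 * p3'))
     (s' * r3 - t * r3' + (p1 * p2' - p2 * p1'))
     (- (p1' * r1 + p2' * r2 + p3' * r3 + t * t')).
Proof. by rewrite /omul /= /mk !row3E !mulNr !mulrN opprK. Qed.

Lemma mk_mulT x y : omul true x y = omul false y x.
Proof. by []. Qed.

Definition mkE :=
  (mk_mulT, mk_mulF, mk_bf, mk_cj, mk_add, mk_opp, mk_scale, mk0).

Ltac coords x :=
  let H := fresh in
  have H := mkP x;
  move: H => [?] [?] [?] [?] [?] [?] [?] [?] ->.


Lemma omulC op x y : omul op x y = omul (~~ op) y x.
Proof. by case: op. Qed.

Lemma omulDl op x y z : omul op (x + y) z = omul op x z + omul op y z.
Proof. coords x; coords y; coords z; case: op; rewrite !mkE; congr mk;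
  ring. Qed.

Lemma omulDr op x y z : omul op z (x + y) = omul op z x + omul op z y.
Proof. by rewrite !(omulC op) omulDl. Qed.
(** Polarisation in [x] of the alternative law: the conjugate of [x] times [x y] is N(x) y. The
    variants [mul_cjK], [mulK_cj] and [mulcj_K] follow by conjugating [x] and [z] and by passing to
    the opposite product. *)
Lemma cj_mulK op x y z :
  omul op (cj x) (omul op z y) + omul op (cj z) (omul op x y) = - bf x z *: y.
Proof.
coords x; coords y; coords z; case: op; rewrite !mkE; congr mk; ring.
Qed.


Lemma omulZl op k x y : omul op (k *: x) y = k *: omul op x y.
Proof. coords x; coords y; case: op; rewrite !mkE; congr mk; ring. Qed.

Lemma omulZr op k x y : omul op x (k *: y) = k *: omul op x y.
Proof. by rewrite !(omulC op) omulZl. Qed.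

Lemma omulNl op x y : omul op (- x) y = - omul op x y.
Proof. by rewrite -scaleN1r omulZl scaleN1r. Qed.

Lemma omul0l op x : omul op 0 x = 0.
Proof. by rewrite -(scale0r (0 : R44 R)) omulZl !scale0r. Qed.

Lemma omul0r op x : omul op x 0 = 0.
Proof. by rewrite -(scale0r (0 : R44 R)) omulZr !scale0r. Qed.

Lemma bfC x y : bf x y = bf y x.
Proof. coords x; coords y; rewrite !mkE; ring. Qed.

Lemma bfDl x y z : bf (x + y) z = bf x z + bf y z.
Proof. coords x; coords y; coords z; rewrite !mkE; ring. Qed.

Lemma bfZl k x y : bf (k *: x) y = k * bf x y.
Proof. coords x; coords y; rewrite !mkE; ring. Qed.

Lemma bf0l x : bf 0 x = 0.
Proof. by rewrite -(scale0r (0 : R44 R)) bfZl mul0r. Qed.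

Lemma bf_q x : bf x x = q44 x *+ 2.
Proof. by coords x; rewrite !mkE /q44 /mk !row3E; ring. Qed.

Lemma cjK : involutive cj.
Proof. by move=> x; coords x; rewrite !mkE !opprK. Qed.

Lemma cjZ k x : cj (k *: x) = k *: cj x.
Proof. by coords x; rewrite !mkE; congr mk; ring. Qed.

Lemma bf_cj x y : bf (cj x) (cj y) = bf x y.
Proof. coords x; coords y; rewrite !mkE; ring. Qed.

Lemma bf_mull op x y z : bf (omul op x y) z = bf y (omul op (cj x) z).
Proof. coords x; coords y; coords z; case: op; rewrite !mkE; ring. Qed.

Lemma bf_mulr op x y z : bf (omul op x y) z = bf x (omul op z (cj y)).
Proof. by rewrite !(omulC op) bf_mull. Qed.

Lemma mul_cjK op x y z :
  omul op x (omul op (cj z) y) + omul op z (omul op (cj x) y) = - bf x z *: y.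
Proof. by rewrite -{1}(cjK x) -{2}(cjK z) cj_mulK bf_cj. Qed.

Lemma mulK_cj op x y z :
  omul op (omul op y x) (cj z) + omul op (omul op y z) (cj x) = - bf x z *: y.
Proof. by rewrite addrC; rewrite !(omulC op) cj_mulK. Qed.

Lemma mulcj_K op x y z :
  omul op (omul op y (cj x)) z + omul op (omul op y (cj z)) x = - bf x z *: y.
Proof. by rewrite addrC; rewrite !(omulC op) mul_cjK. Qed.

(** Polarisation in [x] of the Moufang identity (x a)(b x) = x (a b) x, whose right side is - bf(x,
    m) x + q(x) m. *)
Lemma moufang op x a b y (m := cj (omul op a b)) :
  omul op (omul op x a) (omul op b y) + omul op (omul op y a) (omul op b x) =
  - bf x m *: y - bf y m *: x + bf x y *: m.
Proof.
rewrite {}/m; coords x; coords a; coords b; coords y.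
case: op; rewrite !mkE; congr mk; ring.
Qed.

(** Polarisation in [x] of the formula x (y' x) = - bf(x, y) x + q(x) y, where y' is the conjugate
    of y. *)
Lemma mul_cj_swap op x a y :
  omul op x (omul op (cj y) a) + omul op a (omul op (cj y) x) =
  - bf x y *: a - bf a y *: x + bf a x *: y.
Proof.
coords x; coords a; coords y.
case: op; rewrite !mkE; congr mk; ring.
Qed.

(** The last coordinate is [- 1] because [rho] negates it. *)
Definition omul1 : R44 R := mk 0 0 0 1 0 0 0 (- 1).

Lemma omul1l op x : omul op omul1 x = x.
Proof. by rewrite /omul1; coords x; case: op; rewrite !mkE; congr mk; ring. Qed.

(* The pairs (e_i, f_i) form a hyperbolic basis, so [cj e_i (f_i k) +
   cj f_i (e_i k)] sums to [- 4 k]; the other terms sum to [cj y x - cj x y],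
   which is [2 k] up to the trace [bf x y]. *)
Lemma hyperbolic_average op x y (k := omul op (cj y) x)
    (T := fun a => omul op a k - bf a x *: y + bf a y *: x)
    (e1 := mk 1 0 0 0 0 0 0 0) (f1 := mk 0 0 0 0 1 0 0 0)
    (e2 := mk 0 1 0 0 0 0 0 0) (f2 := mk 0 0 0 0 0 1 0 0)
    (e3 := mk 0 0 1 0 0 0 0 0) (f3 := mk 0 0 0 0 0 0 1 0)
    (e4 := mk 0 0 0 1 0 0 0 0) (f4 := mk 0 0 0 0 0 0 0 1) :
  omul op (cj e1) (T f1) + omul op (cj f1) (T e1) +
  (omul op (cj e2) (T f2) + omul op (cj f2) (T e2)) +
  (omul op (cj e3) (T f3) + omul op (cj f3) (T e3)) +
  (omul op (cj e4) (T f4) + omul op (cj f4) (T e4)) =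
  - 2 *: k + bf x y *: omul1.
Proof.
rewrite {}/T {}/k {}/e1 {}/f1 {}/e2 {}/f2 {}/e3 {}/f3 {}/e4 {}/f4 /omul1.
coords x; coords y; case: op; rewrite !mkE; congr mk; ring.
Qed.

End Algebra.

(** * Linear algebra of the form [bf]: dual vectors and isotropic families *)

Section LinearAlgebra.
Context {R : realType}.
Implicit Types (a b c x y z u v w : R44 R) (op : bool).

Definition crd (j : 'I_8) (v : R44 R) : R :=
  let: (x, s, y, t) := v in
  [:: x 0 0; x 0 1; x 0 2%:R; s; y 0 0; y 0 1; y 0 2%:R; t]`_j.

Lemma crd_linear (j : 'I_8) k x y : crd j (k *: x + y) = k * crd j x + crd j y.
Proof.
case: x => [[[p s] r] t]; case: y => [[[p' s'] r'] t'].
by case: j => -[|[|[|[|[|[|[|[|m]]]]]]]] // ? /=; rewrite ?mxE.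
Qed.

(** The Gram matrix of [bf] in the coordinates [crd]: it turns [bf] into the dot product of rows,
    which gives access to matrix ranks. *)
Definition swap44 (v : R44 R) : R44 R := let: (x, s, y, t) := v in (y, t, x, s).

Lemma swap44_linear k x y : swap44 (k *: x + y) = k *: swap44 x + swap44 y.
Proof. by case: x => [[[p s] r] t]; case: y => [[[p' s'] r'] t']. Qed.

Lemma swap44K : involutive swap44.
Proof. by move=> [[[p s] r] t]. Qed.

Definition row_of (v : R44 R) : 'rV[R]_8 := \row_j crd j v.

Definition of_row (r : 'rV[R]_8) : R44 R :=
  mk (r 0 0) (r 0 1) (r 0 2%:R) (r 0 3%:R) (r 0 4%:R) (r 0 5%:R) (r 0 6%:R)
    (r 0 7%:R).

Lemma crd_mk (j : 'I_8) (p1 p2 p3 s r1 r2 r3 t : R) :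
  crd j (mk p1 p2 p3 s r1 r2 r3 t) = [:: p1; p2; p3; s; r1; r2; r3; t]`_j.
Proof. by rewrite /= !mxE. Qed.

Lemma of_rowK : cancel of_row row_of.
Proof.
move=> r; apply/rowP => j; rewrite mxE crd_mk.
by case: j => -[|[|[|[|[|[|[|[|m]]]]]]]] //= ?; congr (r _ _); apply: val_inj.
Qed.

Lemma row_ofK : cancel row_of of_row.
Proof.
move=> x; have [p1 [p2 [p3 [s [r1 [r2 [r3 [t ->]]]]]]]] := mkP x.
by rewrite /of_row !mxE !crd_mk.
Qed.

Lemma crd_ext x y : (forall j, crd j x = crd j y) -> x = y.
Proof. by move=> xy; apply: (can_inj row_ofK); apply/rowP => j;
  rewrite !mxE. Qed.

Lemma bf_row x y : bf x y = (row_of x *m (row_of (swap44 y))^T) 0 0.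
Proof.
rewrite mxE.
have [p1 [p2 [p3 [s [r1 [r2 [r3 [t ->]]]]]]]] := mkP x.
have [p1' [p2' [p3' [s' [r1' [r2' [r3' [t' ->]]]]]]]] := mkP y.
rewrite mkE (_ : swap44 _ = mk r1' r2' r3' t' p1' p2' p3' s')//.
by rewrite !big_ord_recr big_ord0 /= !mxE !crd_mk /=; ring.
Qed.

Lemma row_of_sum n (u : 'I_n -> R44 R) (c : 'I_n -> R) :
  row_of (\sum_i c i *: u i) = \row_i c i *m \matrix_i row_of (u i).
Proof.
have row_of_linear k x y : row_of (k *: x + y) = k *: row_of x + row_of y.
  by apply/rowP => j; rewrite !mxE crd_linear.
have row_of0 : row_of 0 = 0.
  by rewrite -[X in row_of X](addNr 0) -scaleN1r row_of_linear scaleN1r addNr.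
rewrite mulmx_sum_row (big_morph row_of (id1 := 0) (op1 := +%R)) //.
  apply: eq_bigr => i _; rewrite -[X in row_of X]addr0 row_of_linear row_of0.
  by rewrite addr0 rowK mxE.
by move=> x y; rewrite -[x]scale1r row_of_linear !scale1r.
Qed.

Definition indep n (u : 'I_n -> R44 R) :=
  forall c : 'I_n -> R, \sum_i c i *: u i = 0 -> forall i, c i = 0.

Lemma indep_row_free n (u : 'I_n -> R44 R) :
  indep u -> row_free (\matrix_i row_of (u i)).
Proof.
move=> iu; rewrite -kermx_eq0; apply/rowV0P => r /sub_kermxP r0.
apply/rowP => i; rewrite mxE; apply: (iu (fun i => r 0 i)).
apply: (can_inj row_ofK); rewrite row_of_sum.
rewrite (_ : \row_i _ = r); last by apply/rowP => j; rewrite mxE.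
by rewrite r0; apply/rowP => j; rewrite !mxE mk0 crd_mk;
  case: j => -[|[|[|[|[|[|[|[|m]]]]]]]].
Qed.

(** The matrix of a free family has a right inverse; applied to the column of the [k i], it yields
    [a] up to [swap44]. *)
Lemma indep_dual n (u : 'I_n -> R44 R) (k : 'I_n -> R) :
  indep u -> exists a, forall i, bf (u i) a = k i.
Proof.
move=> /indep_row_free /row_freeP[B uB].
exists (swap44 (of_row (B *m \col_i k i)^T)) => i.
rewrite bf_row swap44K of_rowK trmxK -[row_of (u i)](rowK (fun i => row_of (u
  i))).
by rewrite -row_mul mulmxA uB mul1mx !mxE.
Qed.

(** The matrices of [u] and of its image by [swap44] both have rank [n], and the first times the
    transpose of the second is 0, so [n + n <= 8]. *)
Lemma isotropic_dep n (u : 'I_n -> R44 R) :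
  (forall i j, bf (u i) (u j) = 0) -> indep u -> (n <= 4)%N.
Proof.
move=> u0 iu; have iu' : indep (swap44 \o u).
  move=> c c0; apply: iu; apply: (can_inj swap44K); rewrite -[RHS]/(0 : R44 R).
  rewrite -[RHS]c0 (big_morph swap44 (id1 := 0) (op1 := +%R)) //.
    by apply: eq_bigr => i _; rewrite -[X in swap44 X]addr0 swap44_linear addr0.
  by move=> x y; rewrite -[x]scale1r swap44_linear !scale1r.
move: (indep_row_free iu) (indep_row_free iu').
rewrite /row_free => /eqP r1 /eqP r2.
have /mulmx0_rank_max : (\matrix_i row_of (u i)) *m
    (\matrix_i row_of ((swap44 \o u) i))^T = 0 :> 'M[R]_n.
  apply/matrixP => i j; rewrite [RHS]mxE -[RHS](u0 i j) bf_row !mxE.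
  by apply: eq_bigr => l _; rewrite !mxE.
by rewrite mxrank_tr r1 r2 addnn -[8%N]/(4.*2)%N leq_double.
Qed.

Definition indep3 u v w := forall k l m : R,
  k *: u + l *: v + m *: w = 0 -> [/\ k = 0, l = 0 & m = 0].

Lemma indep3P u v w : indep3 u v w -> indep (fun i : 'I_3 => [:: u; v; w]`_i).
Proof.
move=> iuvw c; rewrite !big_ord_recr big_ord0 /= add0r => /iuvw[c0 c1 c2].
by case=> -[|[|[|m]]] // i3; [rewrite -c0|rewrite -c1|rewrite -c2];
  congr c; apply: val_inj.
Qed.

Lemma indep3_dual u v w (k l m : R) : indep3 u v w ->
  exists a, [/\ bf u a = k, bf v a = l & bf w a = m].
Proof.
move=> /indep3P /(indep_dual (fun i => [:: k; l; m]`_i))[a ha].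
by exists a; split; [apply: (ha 0)|apply: (ha 1)|apply: (ha 2%:R)].
Qed.

Lemma nondegenerate x (k : R) : x != 0 -> exists a, bf x a = k.
Proof.
move=> x0; have : indep (fun i : 'I_1 => x).
  move=> c; rewrite big_ord1 => /eqP; rewrite scaler_eq0 (negbTE x0) orbF.
  by move=> /eqP c0 i; rewrite ord1.
by move=> /(indep_dual (fun _ => k))[a /(_ 0)]; exists a.
Qed.

Lemma bf_eq0 x : (forall y, bf x y = 0) -> x = 0.
Proof.
move=> x0; apply/eqP/negPn/negP => /(nondegenerate 1)[a].
by rewrite x0 => /esym/eqP; rewrite oner_eq0.
Qed.

(** Five vectors of a totally isotropic set are dependent, and [x], [y] cannot both have coefficient
    0 as [u], [v], [w] are free. It expresses that a 3-space is a hyperplane in a maximal isotropic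
    space. *)
Lemma isotropic_codim1 u v w x y (P : set (R44 R)) : indep3 u v w ->
  (forall a b, P a -> P b -> bf a b = 0) ->
  P u -> P v -> P w -> P x -> P y ->
  exists k l, [/\ (k != 0) || (l != 0) & exists k1 k2 k3 : R,
    k *: x + l *: y = k1 *: u + k2 *: v + k3 *: w].
Proof.
move=> iuvw P0 Pu Pv Pw Px Py; pose f (i : 'I_5) := [:: u; v; w; x; y]`_i.
have Pf i : P (f i) by case: i => -[|[|[|[|[|m]]]]].
have : ~ indep f by move/(isotropic_dep (fun i j => P0 _ _ (Pf i) (Pf j))).
move=> /existsNP[c /not_implyP[c0 /existsNP[i ci]]].
move: c0; rewrite !big_ord_recr big_ord0 /= add0r /f /=.
set c0 := c _; set c1 := c _; set c2 := c _; set c3 := c _; set c4 := c _ => E.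
exists c3, c4; split; last first.
  exists (- c0), (- c1), (- c2); apply/eqP; rewrite -subr_eq0.
  by rewrite !scaleNr -!opprD opprK addrC addrA E.
rewrite -negb_and; apply/negP => /andP[/eqP c30 /eqP c40].
move: E; rewrite c30 c40 !scale0r !addr0 => /iuvw[c00 c10 c20].
apply: ci; case: i => -[|[|[|[|[|m]]]]] // i5;
  [rewrite -[RHS]c00|rewrite -[RHS]c10|rewrite -[RHS]c20|
   rewrite -[RHS]c30|rewrite -[RHS]c40]; congr c; exact: val_inj.
Qed.

End LinearAlgebra.

Arguments crd {R} j v : simpl never.

(** * Zero divisors and annihilators of isotropic 3-spaces *)

Section Triality.
Context {R : realType}.
Implicit Types (a b c x y z u v w : R44 R) (op : bool).

Lemma addxx_eq0 (V : lmodType R) (x : V) : x + x = 0 -> x = 0.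
Proof.
by move=> /eqP; rewrite -mulr2n -scaler_nat scaler_eq0 pnatr_eq0 => /eqP.
Qed.

Lemma mul_eq0_isotropic op x y : omul op x y = 0 -> y != 0 -> bf x x = 0.
Proof.
move=> xy0 y0; have := cj_mulK op x y x.
rewrite xy0 omul0r addr0 => /esym/eqP.
by rewrite scaler_eq0 (negbTE y0) orbF oppr_eq0 => /eqP.
Qed.

Lemma ker_isotropic op z x y : z != 0 ->
  omul op z x = 0 -> omul op z y = 0 -> bf x y = 0.
Proof.
move=> z0 zx zy; have := mulK_cj op x z y.
rewrite zx zy !omul0l addr0 => /esym/eqP.
by rewrite scaler_eq0 (negbTE z0) orbF oppr_eq0 => /eqP.
Qed.

(** A vector [a] dual to [x] allows division: w = x' (a w) and z = (z a) x', where x' is [cj x]. The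
    Moufang identity then evaluates w z, and only a multiple of x' survives because x' is
    isotropic. *)
Lemma incident_prod op x z w : x != 0 -> bf x x = 0 ->
  omul op z x = 0 -> omul op x w = 0 ->
  exists k, omul op w z = k *: cj x.
Proof.
move=> x0 xx0 zx xw; have [a xa] := nondegenerate (-1) x0.
have := cj_mulK op x w a; rewrite xw omul0r addr0 xa opprK scale1r => <-.
have := mulK_cj op x z a; rewrite zx omul0l add0r xa opprK scale1r => <-.
set b := omul op a w; set c := omul op z a.
exists (- bf (cj x) (cj (omul op b c))).
have := moufang op (cj x) b c (cj x); rewrite /=.
rewrite [bf (cj x) (cj x)]bf_cj xx0 scale0r addr0 -scaleNr -!mulr2n.
by rewrite -[LHS]scaler_nat -[RHS]scaler_nat => /(scalerI _); apply;
  rewrite pnatr_eq0.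
Qed.

(** By [incident_prod] the product is a multiple of both [cj u] and [cj v], which are
    independent. *)
Lemma incident_ortho op u v z w :
  (forall k l : R, k *: u + l *: v = 0 -> k = 0 /\ l = 0) ->
  bf u u = 0 -> bf v v = 0 ->
  omul op z u = 0 -> omul op z v = 0 -> omul op u w = 0 -> omul op v w = 0 ->
  omul op w z = 0.
Proof.
move=> iuv uu vv zu zv uw vw.
have u0 : u != 0.
  apply/eqP => u0; have [|/eqP] := iuv 1 0; last by rewrite oner_eq0.
  by rewrite u0 scaler0 scale0r addr0.
have v0 : v != 0.
  apply/eqP => v0; have [|_ /eqP] := iuv 0 1; last by rewrite oner_eq0.
  by rewrite v0 scaler0 scale0r addr0.
have [k wzu] := incident_prod u0 uu zu uw.
have [l wzv] := incident_prod v0 vv zv vw.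
have [|k0 _] := iuv k (- l); last by rewrite wzu k0 scale0r.
by rewrite scaleNr -[k *: u]cjK cjZ -wzu -[l *: v]cjK cjZ -wzv subrr.
Qed.

Section ThreeSpace.
Variables (op : bool) (u v w : R44 R).
Hypothesis iuvw : indep3 u v w.
Hypotheses (uu : bf u u = 0) (vv : bf v v = 0) (ww : bf w w = 0).
Hypotheses (uv : bf u v = 0) (uw : bf u w = 0) (vw : bf v w = 0).
Local Notation "x ** y" := (omul op x y) (at level 40, left associativity).

(** A Clifford relation: multiplications by orthogonal vectors, one of them conjugated,
    anticommute. *)
Lemma swap_cj x y z : bf x y = 0 -> (z ** x) ** cj y = - (z ** y) ** cj x.
Proof.
move=> xy; apply/eqP; rewrite omulNl -subr_eq0 opprK; apply/eqP.
by rewrite mulK_cj xy oppr0 scale0r.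
Qed.

Lemma cj_swap x y z : bf x y = 0 -> (z ** cj x) ** y = - (z ** cj y) ** x.
Proof.
move=> xy; apply/eqP; rewrite omulNl -subr_eq0 opprK; apply/eqP.
by rewrite mulcj_K xy oppr0 scale0r.
Qed.

Lemma cj_killed x z : bf x x = 0 -> (z ** cj x) ** x = 0.
Proof.
move=> xx; have := mulcj_K op x z x.
by rewrite xx oppr0 scale0r => /addxx_eq0.
Qed.

(* If the composite vanishes, so does its transpose; by the Clifford relations,
   multiplying by vectors dual to u and v then makes c ** w vanish for all c. *)
Lemma clifford3_neq0 : exists c, ((c ** cj w) ** v) ** cj u != 0.
Proof.
apply: contrapT => /forallNP G0'.
have {G0'}G0 c : ((c ** cj w) ** v) ** cj u = 0.
  by apply/eqP/negPn/negP; apply: G0'.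
have H0 c : ((c ** u) ** cj v) ** w = 0.
  apply: bf_eq0 => d; rewrite bf_mulr bf_mulr bf_mulr.
  by rewrite cjK G0 bfC bf0l.
have G1 c : ((c ** cj u) ** v) ** cj w = 0.
  apply: oppr_inj; rewrite oppr0 -[RHS](G0 c) -omulNl.
  rewrite (swap_cj _ (_ : bf v u = 0)) 1?bfC//.
  rewrite (@cj_swap w u) 1?bfC// !omulNl !opprK.
  by rewrite (swap_cj _ vw) omulNl opprK.
(* The value [- 1] cancels the sign in [mulK_cj] and [mulcj_K], so the two composites of [u] and
   [u'] add up to the identity; orthogonality to [v] and [w] lets [u'] move past them. *)
have [u' [uu' vu' wu']] := indep3_dual (- 1) 0 0 iuvw.
have [v' [_ vv' wv']] := indep3_dual 0 (- 1) 0 iuvw.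
have P1 c : (c ** cj v) ** w = 0.
  have : (c ** cj u') ** u = c - (c ** cj u) ** u'.
    have := mulcj_K op u c u'; rewrite uu' opprK scale1r => H.
    by apply/eqP; rewrite eq_sym subr_eq addrC H.
  move=> E; have := H0 (c ** cj u'); rewrite E omulDl omulNl.
  rewrite (swap_cj _ (_ : bf u' v = 0)) 1?bfC// omulNl opprK omulDl.
  by rewrite (cj_swap _ (_ : bf u' w = 0)) 1?bfC// omulNl G1 omul0l oppr0 addr0.
have P2 c : (c ** v) ** cj w = 0.
  have : (c ** u') ** cj u = c - (c ** u) ** cj u'.
    have := mulK_cj op u c u'; rewrite uu' opprK scale1r => H.
    by apply/eqP; rewrite eq_sym subr_eq addrC H.
  move=> E; have := G1 (c ** u'); rewrite E omulDl omulNl.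
  rewrite (cj_swap _ (_ : bf u' v = 0)) 1?bfC// omulNl opprK omulDl.
  by rewrite (swap_cj _ (_ : bf u' w = 0)) 1?bfC// omulNl H0 omul0l oppr0 addr0.
have P3 c : c ** w = 0.
  have : (c ** v') ** cj v = c - (c ** v) ** cj v'.
    have := mulK_cj op v c v'; rewrite vv' opprK scale1r => H.
    by apply/eqP; rewrite eq_sym subr_eq addrC H.
  move=> E; have := P1 (c ** v'); rewrite E omulDl omulNl.
  by rewrite (cj_swap _ (_ : bf v' w = 0)) 1?bfC// omulNl opprK P2 omul0l addr0.
have w0 : w = 0 by rewrite -(omul1l op w) P3.
have [|_ _ /eqP] := iuvw (_ : 0 *: u + 0 *: v + 1 *: w = 0).
  by rewrite w0 scaler0 !scale0r !addr0.
by rewrite oner_eq0.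
Qed.

(** In the nonzero product of [clifford3_neq0], anticommutation brings any of the three factors next
    to its own copy, where [cj_killed] applies. *)
Lemma exists_annihilator :
  exists z, [/\ z != 0, z ** u = 0, z ** v = 0 & z ** w = 0].
Proof.
have [c c0] := clifford3_neq0; exists (((c ** cj w) ** v) ** cj u); split=> //.
- exact: cj_killed.
- rewrite (swap_cj _ (_ : bf v u = 0)) 1?bfC// omulNl omulNl cj_killed//.
  by rewrite oppr0.
- rewrite (cj_swap _ uw) omulNl (swap_cj _ vw) omulNl omulNl opprK.
  by rewrite cj_killed// !omul0l.
Qed.

(** First z' (cj z a) = 0 for all a. By [mul_cj_swap] this makes every [T a] of [hyperbolic_average]
    vanish, so cj z z' = 0; then [T a = 0] with [a] dual to [z] gives the proportionality. *)
Lemma annihilator_unique z z' : z != 0 ->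
  z ** u = 0 -> z ** v = 0 -> z ** w = 0 ->
  z' ** u = 0 -> z' ** v = 0 -> z' ** w = 0 ->
  exists k, z' = k *: z.
Proof.
move=> z0 zu zv zw z'u z'v z'w.
have u0 : u != 0.
  apply/eqP => u0; have [|/eqP] := iuvw (_ : 1 *: u + 0 *: v + 0 *: w = 0).
    by rewrite u0 scaler0 !scale0r !addr0.
  by rewrite oner_eq0.
have zz : bf z z = 0 := mul_eq0_isotropic zu u0.
have zz' : bf z z' = 0.
  have := cj_mulK op z u z'; rewrite zu z'u !omul0r addr0 => /esym/eqP.
  by rewrite scaler_eq0 (negbTE u0) orbF oppr_eq0 => /eqP.
(* [f] is skew, and it has rank at most one: it factors through the isotropic
   space [ker z], in which u, v, w span a hyperplane killed by [z']. *)
pose f a := z' ** (cj z ** a).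
have f_skew a b : bf (f a) b = - bf a (f b).
  rewrite /f bf_mull bf_mull cjK.
  have := mul_cjK op z b z'; rewrite zz' oppr0 scale0r => /eqP.
  by rewrite addr_eq0 => /eqP->; rewrite -scaleN1r ![bf a _]bfC bfZl mulN1r.
have zcj a : z ** (cj z ** a) = 0.
  by have := mul_cjK op z a z; rewrite zz oppr0 scale0r => /addxx_eq0.
have f0 a : f a = 0.
  apply: bf_eq0 => b.
  have [k [l [kl [k1 [k2 [k3 E]]]]]] := isotropic_codim1 iuvw
    (P := [set x | z ** x = 0]) (fun x y => ker_isotropic z0)
    zu zv zw (zcj a) (zcj b).
  have {E} : k *: f a + l *: f b = 0.
    rewrite /f -(omulZr op k z') -(omulZr op l z') -omulDr E !omulDr !omulZr
      z'u z'v z'w.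
    by rewrite !scaler0 !addr0.
  (* Skewness kills the diagonal. Pairing the relation with [a] and with [b] thus leaves multiples
     of [bf (f b) a] and [bf (f a) b], and [k] or [l] is nonzero. *)
  have fxx x : bf (f x) x = 0.
    by have := f_skew x x; rewrite [bf x _]bfC; lra.
  move=> E; have := congr1 (fun x => bf x b) E.
  have := congr1 (fun x => bf x a) E.
  rewrite !bfDl !bfZl !bf0l !fxx !mulr0 addr0 add0r => /eqP + /eqP.
  rewrite !mulf_eq0 => /orP[/eqP l0|/eqP]; last first.
    by rewrite f_skew bfC => /eqP; rewrite oppr_eq0 => /eqP.
  move=> /orP[/eqP k0|/eqP//]; move: kl; by rewrite k0 l0 eqxx.
have T0 a : omul op a (cj z ** z') - bf a z' *: z + bf a z *: z' = 0.
  have := mul_cj_swap op z' a z; rewrite -/(f a) f0 add0r => ->.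
  by rewrite [bf z' z]bfC zz' oppr0 scale0r sub0r addrK addNr.
have := hyperbolic_average op z' z; cbv beta zeta.
rewrite !T0 !omul0r !addr0 [bf z' z]bfC zz' scale0r addr0 => /esym/eqP.
rewrite scaler_eq0 oppr_eq0 pnatr_eq0 /= => /eqP k0.
have [a za] := nondegenerate 1 z0; exists (bf a z'); have := T0 a.
rewrite k0 omul0r sub0r [bf a z]bfC za scale1r addrC => /eqP.
by rewrite subr_eq0 => /eqP.
Qed.

End ThreeSpace.

(** [incident_prod] leaves one unknown scalar for each of [w a1] and [w a2]; multiplying the
    equality of mixed products by [y w], with [y] dual to [u], reveals both scalars as coefficients
    of a linear relation. *)
Lemma mixed_symmetry op u u1 u2 w a1 a2 : indep3 u u1 u2 ->
  bf u u = 0 -> bf u u1 = 0 -> bf u u2 = 0 ->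
  omul op u w = 0 -> omul op u1 w = 0 -> omul op u2 w = 0 ->
  omul op a1 u = 0 -> omul op a2 u = 0 ->
  omul op a1 u2 = omul op a2 u1 ->
  omul op w a1 = 0 /\ omul op w a2 = 0.
Proof.
move=> iu uu uu1 uu2 uw u1w u2w a1u a2u a12.
have u0 : u != 0.
  apply/eqP => u0; have [|/eqP] := iu 1 0 0.
    by rewrite u0 scaler0 !scale0r !addr0.
  by rewrite oner_eq0.
have [c1 wa1] := incident_prod u0 uu a1u uw.
have [c2 wa2] := incident_prod u0 uu a2u uw.
have [y uy] := nondegenerate (- 1) u0.
(* In the Moufang identity the term starting with [x w] drops out, and the conjugate of [w a] is
   [m *: u], which pairs to 0 with [x] and to [- m] with [y]. *)
have E m a x : omul op w a = m *: cj u -> omul op x w = 0 -> bf u x = 0 ->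
    omul op (omul op y w) (omul op a x) = m *: x + (m * bf x y) *: u.
  move=> wa xw ux; have := moufang op x w a y;
    rewrite /= wa xw omul0l add0r => ->.
  rewrite cjZ cjK ![bf _ (m *: u)]bfC !bfZl ux uy !mulr0 oppr0 scale0r add0r.
  by rewrite mulrN1 scaleNr opprK scalerA mulrC.
have := E _ _ _ wa2 u1w uu1; rewrite -a12 (E _ _ _ wa1 u2w uu2) => F.
(* These are the coefficients of the difference of the two values of [E], for [a1 u2] and for
   [a2 u1]. *)
have [|_ c20 c10] := iu (c1 * bf u2 y - c2 * bf u1 y) (- c2) c1.
  rewrite scalerBl scaleNr -addrA [- _ + _]addrC addrACA -opprD.
  by rewrite [X in X - _]addrC [X in _ - X]addrC F subrr.
by rewrite wa1 wa2 c10 (eqP (_ : c2 == 0)) ?scale0r// -oppr_eq0 c20.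
Qed.

End Triality.

(** * Symmetry of second derivatives *)

Section Schwarz.
Context {R : realType} {V : normedModType R}.
Implicit Types (f g : V -> R^o) (p x y v w : V).

Lemma is_derive_line g p v (s : R) : differentiable g (p + s *: v) ->
  is_derive s 1 (fun r : R => g (p + r *: v)) ('D_v g (p + s *: v)).
Proof.
move=> dg.
have dl : is_diff (s : R^o) (fun r : R^o => p + r *: v) (fun r => r *: v).
  by apply: is_diff_eq; rewrite add0r.
have dc : is_diff s (g \o fun r : R^o => p + r *: v)
    ('d g (p + s *: v) \o (fun r => r *: v)).
  by apply: is_diff_comp; apply: differentiableP.
apply: DeriveDef; first by apply/derivable1_diffP; case: dc.
rewrite deriveE; last by case: dc.
by rewrite diff_val /= scale1r deriveE.
Qed.

(** The mean value theorem is applied twice: along [v] to the difference of [f] over the step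
    [h *: w], then along [w] to [fv]. *)
Lemma second_difference f fv v w x (h : R) (h0 : 0 < h) :
  (forall s t, 0 <= s <= h -> 0 <= t <= h -> let y := x + s *: v + t *: w in
     [/\ differentiable f y, 'D_v f y = fv y & differentiable fv y]) ->
  exists s t, [/\ 0 <= s <= h, 0 <= t <= h &
    f (x + h *: v + h *: w) - f (x + h *: v) - f (x + h *: w) + f x =
    'D_w fv (x + s *: v + t *: w) * h * h].
Proof.
move=> df.
have hh : 0 <= h <= h by rewrite lexx andbT ltW.
have h00 : 0 <= (0 : R) <= h by rewrite lexx ltW.
pose phi (s : R) : R := f (x + h *: w + s *: v) - f (x + s *: v).
pose dphi (s : R) := fv (x + h *: w + s *: v) - fv (x + s *: v).
have dphiE s : 0 <= s <= h -> is_derive s 1 phi (dphi s).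
  move=> sh; apply: is_deriveB.
    by rewrite addrAC; have [d1 <- _] := df s h sh hh;
       rewrite addrAC; apply: is_derive_line; rewrite addrAC.
  have := df s 0 sh h00; rewrite scale0r addr0 => -[d1 <- _].
  exact: is_derive_line.
have [s| |s sh] := @MVT_segment R phi dphi 0 h (ltW h0).
- by rewrite in_itv /= => /andP[s0 sh]; apply: dphiE; rewrite !ltW.
- apply: derivable_within_continuous => s; rewrite in_itv /= => sh.
  by have [] := dphiE _ sh.
rewrite in_itv /= in sh.
rewrite subr0 => E1.
pose psi (t : R) : R := fv (x + s *: v + t *: w).
have dpsi t : 0 <= t <= h ->
    is_derive t 1 psi ('D_w fv (x + s *: v + t *: w)).
  by move=> th; apply: is_derive_line; have [] := df s t sh th.
have [t| |t th] :=
  @MVT_segment R psi (fun t => 'D_w fv (x + s *: v + t *: w)) 0 h (ltW h0).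
- by rewrite in_itv /= => /andP[t0 th]; apply: dpsi; rewrite !ltW.
- apply: derivable_within_continuous => t; rewrite in_itv /= => th.
  by have [] := dpsi _ th.
rewrite in_itv /= in th.
rewrite subr0 => E2; exists s, t; split => //.
rewrite -E2 /psi scale0r addr0 [x + s *: v + _]addrAC -/(dphi s) -E1 /phi.
by rewrite !scale0r !addr0 [x + h *: w + _]addrAC opprD opprK addrA.
Qed.

Lemma near_parallelogram x v w (P : set V) : nbhs x P ->
  exists h : R, 0 < h /\ forall s t, 0 <= s <= h -> 0 <= t <= h ->
    P (x + s *: v + t *: w).
Proof.
move=> /nbhs_ballP[e /= e0 eP].
(* The added 1 keeps [d] positive when [v = w = 0] and makes the final bound strict. *)
pose d := `|v| + `|w| + 1.
have d0 : 0 < d by rewrite /d ltr_wpDl// addr_ge0.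
exists (e / d); split=> [|s t /andP[s0 sh] /andP[t0 th]]; first exact: divr_gt0.
apply: eP; rewrite -ball_normE /= -addrA opprD addrA subrr add0r normrN.
apply: (le_lt_trans (ler_normD _ _)); rewrite !normrZ !ger0_norm//.
apply: (@le_lt_trans _ _ (e / d * (`|v| + `|w|))).
  by rewrite mulrDr lerD// ler_wpM2r.
by rewrite -mulrA gtr_pMr// mulrC ltr_pdivrMr// mul1r /d ltrDl.
Qed.

(** The second difference is symmetric in [v] and [w], so the two mixed derivatives take a common
    value at points arbitrarily close to [x]. With [e] half of their supposed gap at [x], continuity
    gives a contradiction. *)
Theorem schwarz f fv fw fvw fwv (U : set V) x v w : open U -> U x ->
  (forall y, U y -> differentiable f y) ->
  (forall y, U y -> 'D_v f y = fv y) -> (forall y, U y -> 'D_w f y = fw y) ->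
  (forall y, U y -> differentiable fv y) ->
  (forall y, U y -> differentiable fw y) ->
  (forall y, U y -> 'D_w fv y = fvw y) ->
  (forall y, U y -> 'D_v fw y = fwv y) ->
  {for x, continuous fvw} -> {for x, continuous fwv} ->
  fvw x = fwv x.
Proof.
move=> oU Ux df fvE fwE dfv dfw fvwE fwvE cwv cvw.
have nU : nbhs x U by rewrite nbhsE; exists U.
set L := LHS; set L' := RHS; apply/eqP/negPn/negP => LL'.
pose e := `|L - L'| / 2.
have e0 : 0 < e by rewrite divr_gt0// normr_gt0 subr_eq0.
have nwv : \forall y \near x, `|L - fvw y| < e.
  by move/cvgrPdist_lt : cwv; apply.
have nvw : \forall y \near x, `|L' - fwv y| < e.
  by move/cvgrPdist_lt : cvw; apply.
have [h [h0 Ph]] := near_parallelogram v w (filterI nU (filterI nwv nvw)).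
have [|s [t [sh th E1]]] := @second_difference f fv v w x h h0.
  by move=> s t sh th y; have [Uy _] := Ph _ _ sh th; split; auto.
have [|t' [s' [th' sh' E2]]] := @second_difference f fw w v x h h0.
  move=> t' s' th' sh'; have [Uy _] := Ph _ _ sh' th'.
  by rewrite /= addrAC; split; auto.
have [U1 [A1 _]] := Ph _ _ sh th.
have [U2 [_ A2]] := Ph _ _ sh' th'.
move: E2; rewrite [x + h *: w + _]addrAC [X in X + f x]addrAC E1.
move=> /(mulIf (lt0r_neq0 h0)) /(mulIf (lt0r_neq0 h0)).
rewrite [x + t' *: w + _]addrAC fvwE// fwvE// => E.
suff : `|L - L'| < `|L - L'| by rewrite ltxx.
rewrite [ltRHS]splitr -/e.
rewrite -(subrKA (fvw (x + s *: v + t *: w)) L).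
apply: (le_lt_trans (ler_normD _ _)); apply: ltrD; first exact: A1.
by rewrite E distrC; exact: A2.
Qed.
End Schwarz.

(** * Differentiation of products and coordinates in R^(4,4) *)

Section Differentiation.
Context {R : realType}.
Implicit Types (op : bool).

Lemma continuous_crd (j : 'I_8) : continuous (crd j : R44 R -> R^o).
Proof.
have cfst (A B : topologicalType) : continuous (@fst A B) by move=> ?;
  exact: cvg_fst.
have csnd (A B : topologicalType) : continuous (@snd A B) by move=> ?;
  exact: cvg_snd.
have c0 : continuous (fst \o fst : R44 R -> _).
  by move=> v; apply: continuous_comp; exact: cfst.
have c1 : continuous (fst \o (fst \o fst) : R44 R -> _).
  by move=> v; apply: continuous_comp; [exact: c0|exact: cfst].
have c2 : continuous (snd \o (fst \o fst) : R44 R -> _).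
  by move=> v; apply: continuous_comp; [exact: c0|exact: csnd].
have c3 : continuous (snd \o fst : R44 R -> _).
  by move=> v; apply: continuous_comp; [exact: cfst|exact: csnd].
have cx i : continuous ((fun M : 'rV_3 => M 0 i : R^o) \o
    (fst \o (fst \o fst)) : R44 R -> R^o).
  by move=> v; apply: continuous_comp; [exact: c1|exact: coord_continuous].
have cy i : continuous ((fun M : 'rV_3 => M 0 i : R^o) \o
    (snd \o fst) : R44 R -> R^o).
  by move=> v; apply: continuous_comp; [exact: c3|exact: coord_continuous].
have E (g : R44 R -> R^o) : continuous g -> crd j =1 g -> continuous (crd j :
  R44 R -> R^o).
  by move=> + /funext ->.
case: j E => -[|[|[|[|[|[|[|[|m]]]]]]]] // j8 E.
- by apply: (E _ (cx 0)) => -[[[]]].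
- by apply: (E _ (cx 1)) => -[[[]]].
- by apply: (E _ (cx 2%:R)) => -[[[]]].
- by apply: (E _ c2) => -[[[]]].
- by apply: (E _ (cy 0)) => -[[[]]].
- by apply: (E _ (cy 1)) => -[[[]]].
- by apply: (E _ (cy 2%:R)) => -[[[]]].
- by apply: (E snd) => [|[[[]]]//]; exact: csnd.
Qed.

Lemma crd_scalar (j : 'I_8) : scalar (@crd R j).
Proof. by move=> k x y; rewrite crd_linear. Qed.

HB.instance Definition _ (j : 'I_8) :=
  GRing.isLinear.Build R (R44 R) R *%R (crd j) (crd_scalar j).

(* [crd j] with its linear structure over [*:%R], as the lemmas on derivatives
   require; that over [*%R] makes it a scalar form. *)
Definition crdo (j : 'I_8) : R44 R -> R^o := crd j.

Lemma crdo_linear (j : 'I_8) : linear (crdo j).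
Proof. by move=> k x y; rewrite /crdo crd_linear. Qed.

HB.instance Definition _ (j : 'I_8) :=
  GRing.isLinear.Build R (R44 R) R^o *:%R (crdo j) (crdo_linear j).

Lemma omul_is_bilinear op :
  bilinear_for *:%R *:%R (omul op : R44 R -> R44 R -> R44 R).
Proof.
split=> [x|x] k y z /=; first by rewrite omulDl omulZl.
by rewrite omulDr omulZr.
Qed.

HB.instance Definition _ op :=
  bilinear_isBilinear.Build R (R44 R) (R44 R) (R44 R) *:%R *:%R (omul op)
    (omul_is_bilinear op).

Definition basis44 (j : 'I_8) : R44 R := of_row (delta_mx 0 j).

Lemma crd_sum (x : R44 R) : x = \sum_j crd j x *: basis44 j.
Proof.
apply: (can_inj row_ofK); rewrite row_of_sum.
rewrite (_ : \matrix_i _ = 1%:M) ?mulmx1; last first.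
  by apply/row_matrixP => i; rewrite rowK of_rowK row1.
by apply/rowP => i; rewrite !mxE.
Qed.

(** Expanding both factors in [basis44] gives a finite sum of products of coordinates. *)
Lemma continuous_omul op :
  continuous (fun p : R44 R * R44 R => omul op p.1 p.2).
Proof.
have -> : (fun p : R44 R * R44 R => omul op p.1 p.2) = fun p =>
    \sum_i \sum_j (crdo i p.1 * crdo j p.2) *: omul op (basis44 i) (basis44 j).
  apply/funext => -[x y] /=; rewrite [in LHS](crd_sum x) linear_sumlz.
  apply: eq_bigr => i _; rewrite [in LHS](crd_sum y) linear_sumr.
  by apply: eq_bigr => j _; rewrite -[LHS]/(omul op _ _) omulZl omulZr scalerA.
move=> p; apply: cvg_big => [|i _]; first exact: add_continuous.
apply: cvg_big => [|j _]; first exact: add_continuous.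
apply: cvgZr_tmp; apply: cvgM.
  by apply: continuous_comp; [exact: cvg_fst|exact: continuous_crd].
by apply: continuous_comp; [exact: cvg_snd|exact: continuous_crd].
Qed.

Section Derive.
Context {V : normedModType R}.

Lemma derive_bilin (W1 W2 W3 : normedModType R)
    (m : {bilinear W1 -> W2 -> W3}) (f : V -> W1) (g : V -> W2) x v :
  continuous (fun p => m p.1 p.2) -> differentiable f x -> differentiable g x ->
  'D_v (fun y => m (f y) (g y)) x = m (f x) ('D_v g x) + m ('D_v f x) (g x).
Proof.
move=> cm df dg; rewrite !deriveE//; last first.
  apply: (@differentiable_comp _ _ _ _ (fun y => (f y, g y)) (fun p => m p.1
    p.2)).
    exact: differentiable_pair.
  exact: differentiable_bilin.
rewrite (@diff_comp _ _ _ _ (fun y => (f y, g y)) (fun p => m p.1 p.2))//.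
- by rewrite diff_bilin// diff_pair.
- exact: differentiable_pair.
- exact: differentiable_bilin.
Qed.

Lemma derive_comp (W1 W2 : normedModType R) (f : V -> W1) (g : W1 -> W2) x v :
  differentiable f x -> differentiable g (f x) ->
  'D_v (g \o f) x = 'd g (f x) ('D_v f x).
Proof.
move=> df dg; rewrite deriveE; last exact: differentiable_comp.
by rewrite diff_comp// deriveE.
Qed.

Lemma derive_omul op (f g : V -> R44 R) x v :
  differentiable f x -> differentiable g x ->
  'D_v (fun y => omul op (f y) (g y)) x =
  omul op (f x) ('D_v g x) + omul op ('D_v f x) (g x).
Proof. exact/derive_bilin/continuous_omul. Qed.

Lemma derive_scale (k : V -> R^o) (f : V -> R44 R) x v :
  differentiable k x -> differentiable f x ->
  'D_v (fun y => k y *: f y) x = k x *: 'D_v f x + 'D_v k x *: f x.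
Proof.
have sb : bilinear_for *:%R *:%R ( *:%R : R^o -> R44 R -> R44 R).
  split=> [y|y] a b z /=; first by rewrite scalerDl scalerA.
  by rewrite scalerDr !scalerA mulrC.
pose sM := bilinear_isBilinear.Build R R^o (R44 R) (R44 R) *:%R *:%R _ sb.
pose sL : {bilinear R^o -> R44 R -> R44 R} := HB.pack ( *:%R : R^o -> R44 R ->
  R44 R) sM.
apply: (derive_bilin (m := sL)); exact: scale_continuous.
Qed.

Lemma differentiable_crd j (f : V -> R44 R) x :
  differentiable f x -> differentiable (crdo j \o f) x.
Proof.
move=> df; apply: differentiable_comp => //.
by apply: linear_differentiable; exact: continuous_crd.
Qed.

Lemma derive_crd j (f : V -> R44 R) x v :
  differentiable f x -> 'D_v (crdo j \o f) x = crdo j ('D_v f x).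
Proof.
move=> df; rewrite !deriveE//; last exact: differentiable_crd.
rewrite diff_comp//=; last first.
  by apply: linear_differentiable; exact: continuous_crd.
by rewrite diff_lin//; exact: continuous_crd.
Qed.

(** The scalar theorem applies to each coordinate, since [crdo j] commutes with directional
    derivatives. *)
Lemma schwarz44 (f : V -> R44 R) (U : set V) x v w : open U -> U x ->
  smooth_on U f -> 'D_w ('D_v f) x = 'D_v ('D_w f) x.
Proof.
move=> oU Ux sf; apply: crd_ext => j.
have [df _] := sf 1%N.
have dvf u y : U y -> differentiable ('D_u f) y.
  by have [_ /(_ u)[duf _]] := sf 2%N; exact: duf.
have nU y : U y -> nbhs y U by move=> Uy; rewrite nbhsE; exists U.
have dE u y : U y -> 'D_u (crdo j \o f) y = crdo j ('D_u f y).
  by move=> Uy; apply: derive_crd; exact: df.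
have dE2 u u' y : U y ->
    'D_u' (crdo j \o 'D_u f) y = crdo j ('D_u' ('D_u f) y).
  by move=> Uy; apply: derive_crd; exact: dvf.
have cf u u' : {for x, continuous (crdo j \o 'D_u' ('D_u f))}.
  apply: continuous_comp; last exact: continuous_crd.
  by have [_ /(_ u)[_ /(_ u') cuu']] := sf 2%N; exact: cuu' x Ux.
apply: (schwarz (f := crdo j \o f) (fv := crdo j \o 'D_v f)
  (fw := crdo j \o 'D_w f) (fvw := crdo j \o 'D_w ('D_v f))
  (fwv := crdo j \o 'D_v ('D_w f)) oU Ux) => //.
- by move=> y Uy; apply: differentiable_crd; exact: df.
- exact: dE.
- exact: dE.
- by move=> y Uy; apply: differentiable_crd; exact: dvf.
- by move=> y Uy; apply: differentiable_crd; exact: dvf.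
- exact: dE2.
- exact: dE2.
Qed.

End Derive.
End Differentiation.

(** * Points of the quadric as lines, and their images by [rho] *)

Section Lines.
Context {R : realType}.
Implicit Types (z : quadric R) (op : bool) (v w : R44 R).

Lemma vpick_neq0 z : vpick (val z) != 0.
Proof.
rewrite vpick0; apply/eqP => z0; have /andP[/eqP + _] := svalP z.
by rewrite -/(val z) z0 dimv0.
Qed.

Lemma quadricE z v : v != 0 -> v \in val z -> val z = <[v]>%VS.
Proof.
move=> v0 vz; apply/esym/eqP; rewrite eqEdim -memvE vz /= dim_vline v0.
by have /andP[/eqP-> _] := svalP z.
Qed.

Lemma quadric_line v : v != 0 -> bf v v = 0 ->
  exists z : quadric R, v \in val z.
Proof.
move=> v0 vv; have vl : isotropic_line <[v]>%VS.
  apply/andP; split; first by rewrite dim_vline v0.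
  apply/asboolP => w /= /vlineP[k ->].
  have := bf_q (k *: v); rewrite bfZl bfC bfZl vv !mulr0 => /esym/eqP.
  by rewrite mulrn_eq0 /= => /eqP.
by exists (exist isotropic_line _ vl); exact: memv_line.
Qed.

Lemma rhoZ k v : rho (k *: v) = k *: rho v.
Proof.
case: v => [[[x s] y] t]; congr (_, _, _, _) => /=.
by rewrite scalerN.
Qed.

Lemma rhoV_eq0 (Z : zorn R) : rhoV Z = 0 <-> Z = 0.
Proof.
split=> [Z0|->]; last by rewrite /= oppr0.
by rewrite -[Z]rhoVK Z0 /= oppr0.
Qed.

Lemma rho_image_line v : @rho R @` [set` <[v]>%VS] = [set` <[rho v]>%VS].
Proof.
apply/seteqP; split=> [_ [_ /= /vlineP[k ->] <-]|Z /= /vlineP[k ->]].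
  by rewrite rhoZ; apply: memvZ; exact: memv_line.
by exists (k *: v); rewrite ?rhoZ//=; apply: memvZ; exact: memv_line.
Qed.

(** This replaces the Zorn matrix in the definitions of plus and minus points by a nonzero vector of
    the line. *)
Lemma rho_image_lineP z (P : set (zorn R)) :
  (exists Z, rho @` [set` val z] = [set` <[Z]>%VS] /\ P Z) <->
  (exists v, [/\ v != 0, v \in val z & P (rho v)]).
Proof.
split=> [[Z [zZ PZ]]|[v [v0 vz Pv]]]; last first.
  by exists (rho v); rewrite (quadricE v0 vz) rho_image_line.
have [v vz vZ] : (rho @` [set` val z]) Z by rewrite zZ /= memv_line.
exists v; split=> //; last by rewrite vZ.
(* A zero generator would force the nonzero vector [vpick (val z)] to vanish. *)
apply/eqP => v0; have := vpick_neq0 z.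
have : (rho @` [set` val z]) (rho (vpick (val z))).
  by exists (vpick (val z)) => //=; exact: memv_pick.
rewrite zZ -vZ v0 => kv;
  have /vlineP[k] : rho (vpick (val z)) \in <[rho (0%R : R44 R)]>%VS.
  exact: kv.
rewrite -rhoZ scaler0.
by move=> /(can_inj (@rhoK R)) ->; rewrite eqxx.
Qed.

End Lines.

(** * Plus and minus points, and derivatives read in charts *)

Section Points.
Context {R : realType} {S : smoothSurface R}.
Implicit Types (phi : S -> quadric R) (op : bool) (c d : chart R S).
Implicit Types (U : set S) (psi : S -> R44 R) (p u : S) (z : quadric R).

(** The Boolean is that of [omul], so both families obey the single equation of [is_pointP]. *)
Definition is_point op phi p z := if op then is_minus_point phi p z
  else is_plus_point phi p z.

Definition phi_op op phi := if op then phi_minus phi else phi_plus phi.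

Lemma is_pointP op phi p z : is_point op phi p z <->
  forall v w, v \in val z -> span_at phi p w -> omul op v w = 0.
Proof.
pose P (Z : zorn R) := rho @` span_at phi p `<=` (if op then kerR Z else kerL
  Z).
have -> : is_point op phi p z <->
    exists Z, rho @` [set` val z] = [set` <[Z]>%VS] /\ P Z by rewrite {}/P;
      case: op.
rewrite rho_image_lineP; split=> [[v [v0 vz Pv]]|zP].
  move=> v' w; rewrite (quadricE v0 vz) => /vlineP[k ->] pw.
  rewrite omulZl; suff -> : omul op v w = 0 by rewrite scaler0.
  apply/rhoV_eq0; have := Pv (rho w) (imageP _ pw).
  by case: (op).
have v0 := vpick_neq0 z; have vz := memv_pick (val z).
exists (vpick (val z)); split=> // _ [w pw <-].
have /rhoV_eq0 := zP _ _ vz pw; by case: (op).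
Qed.

Lemma phi_op_point op phi p :
  (exists z, is_point op phi p z) -> is_point op phi p (phi_op op phi p).
Proof. by case: op => -[z zP]; exact: xgetPex (ex_intro _ z zP). Qed.

Lemma open_fwd c U : open U -> open (fwd c @` (U `&` dom c)).
Proof.
move=> oU.
have -> : fwd c @` (U `&` dom c) = fwd c @` dom c `&` bwd c @^-1` U.
  apply/seteqP; split=> [_ [u [Uu cu] <-]|_ [[u cu <-]]] /=.
    by rewrite fwdK//; split => //; exists u.
  by rewrite fwdK// => Uu; exists u.
have := @bwd_continuous R S c.
rewrite continuous_open_subspace; last exact: open_codom.
by move=> /(continuous_inP _ (@open_codom R S c)); apply.
Qed.

Lemma chart_atP p : atlas S (chart_at p) /\ dom (chart_at p) p.
Proof. by split; [exact: chart_at_atlas|exact: dom_chart_at]. Qed.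

Lemma surf_smooth_diff U psi c u : surf_smooth_on U psi -> atlas S c ->
  U u -> dom c u -> differentiable (psi \o bwd c) (fwd c u).
Proof.
move=> sU ac Uu cu; have [+ _] := sU c ac 1%N; apply.
by exists u.
Qed.

Lemma surf_diffE U psi p v : surf_smooth_on U psi -> U p ->
  surf_diff psi p v = 'D_v (psi \o bwd (chart_at p)) (fwd (chart_at p) p).
Proof.
have [ac cp] := chart_atP p.
move=> sU Up; rewrite /surf_diff deriveE; first by [].
exact: surf_smooth_diff sU ac Up cp.
Qed.

(** [surf_diff] uses a chart that varies with the point, whereas differentiating a relation requires
    one fixed chart [c]. The chain rule through the transition map passes from one to the other. *)
Lemma derive_lift_span U psi c u v : open U -> surf_smooth_on U psi ->
  atlas S c -> U u -> dom c u ->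
  lift_span psi u ('D_v (psi \o bwd c) (fwd c u)).
Proof.
move=> oU sU ac Uu cu; set d := chart_at u; have [ad du] := chart_atP u.
exists 0, ('D_v (fwd d \o bwd c) (fwd c u)).
rewrite scale0r add0r (surf_diffE _ sU Uu) -/d.
have dt : differentiable (fwd d \o bwd c) (fwd c u).
  by have [+ _] := transition_smooth ac ad 1%N; apply; exists u.
have dd := surf_smooth_diff sU ad Uu du.
have E : 'D_v (psi \o bwd c) (fwd c u) =
    'D_v ((psi \o bwd d) \o (fwd d \o bwd c)) (fwd c u).
  apply: near_eq_derive; have oO : open (fwd c @` (dom d `&` dom c)).
    exact/open_fwd/open_dom.
  have nO : nbhs (fwd c u) (fwd c @` (dom d `&` dom c)).
    by apply: open_nbhs_nbhs; split => //; exists u.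
  near=> y; have [u' [du' cu'] <-] : (fwd c @` (dom d `&` dom c)) y by near: y.
  by rewrite /= fwdK// fwdK.
have dd' : differentiable (psi \o bwd d) ((fwd d \o bwd c) (fwd c u)).
  by rewrite /= fwdK.
apply: etrans E _; apply: etrans (derive_comp _ dt dd') _.
rewrite [RHS]deriveE; last exact: dd.
by rewrite [(fwd d \o bwd c) _]/= fwdK.
Unshelve. all: by end_near. Qed.

End Points.

(** * Lifts normalised by one coordinate *)

Lemma crdZ (R : realType) j k (x : R44 R) : crd j (k *: x) = k * crd j x.
Proof. exact: (linearZ_LR (crd j)). Qed.

Section Lifts.
Context {R : realType} {S : smoothSurface R}.
Implicit Types (phi : S -> quadric R) (op : bool) (U : set S) (j : 'I_8).
Implicit Types (psi : S -> R44 R) (p u : S) (z : quadric R).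

Definition unit_lift phi j U psi :=
  local_lift phi U psi /\ forall u, U u -> crd j (psi u) = 1.

Definition lamj j : {scalar R44 R} := crd j.

Lemma exists_unit_lift phi p : smooth_map phi -> exists j U,
  [/\ unit_lift phi j U (affine_chart (lamj j) \o phi), U p &
      in_affine_chart (lamj j) (phi p)].
Proof.
move=> sphi; have [j j0] : exists j, crd j (vpick (val (phi p))) != 0.
  apply/existsP; rewrite -negb_forall; apply/negP => /forallP p0.
  have := vpick_neq0 (phi p); apply/negP; rewrite negbK; apply/eqP.
  apply: crd_ext => j; rewrite (eqP (p0 j)).
  by rewrite -(scale0r (0 : R44 R)) crdZ mul0r.
have [U [oU Up Uaff sU]] := sphi p (lamj j) j0.
exists j, U; split=> //; split; last first.
  move=> u /Uaff u0; rewrite /= /affine_chart crdZ.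
  by rewrite mulVf.
split=> // u /Uaff u0; split; last by apply: memvZ; exact: memv_pick.
by rewrite scaler_eq0 invr_eq0 negb_or u0 vpick_neq0.
Qed.

(** Any other lift is a function times [psi]; by the product rule its derivatives stay in the span
    of [psi p] and the derivatives of [psi]. *)
Lemma span_at_unit_lift phi j U psi p : unit_lift phi j U psi -> U p ->
  span_at phi p `<=` lift_span psi p.
Proof.
move=> [[oU sU Upsi] Uj] Up w [U' [psi' [[oU' sU' Upsi'] U'p [a [v ->]]]]].
have [ac cp] := chart_atP p; set c := chart_at p in ac cp.
(* As [psi] has coordinate [j] equal to 1, the factor is this coordinate of [psi'], which makes it
   differentiable. *)
pose k : S -> R := crd j \o psi'.
have psiE u : U u -> U' u -> psi' u = k u *: psi u.
  move=> Uu U'u; have [u0 ulift] := Upsi u Uu.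
  have [_ u'lift] := Upsi' u U'u.
  move: u'lift; rewrite (quadricE u0 ulift) => /vlineP[l E].
  by rewrite /k /= E crdZ Uj// mulr1.
rewrite (surf_diffE _ sU' U'p) -/c.
have df := surf_smooth_diff sU ac Up cp.
have df' := surf_smooth_diff sU' ac U'p cp.
have E : 'D_v (psi' \o bwd c) (fwd c p) =
    'D_v (fun y => (crdo j \o (psi' \o bwd c)) y *: (psi \o bwd c) y) (fwd c p).
  apply: near_eq_derive.
  have oO : open (fwd c @` ((U `&` U') `&` dom c)).
    exact/open_fwd/openI.
  have nO : nbhs (fwd c p) (fwd c @` ((U `&` U') `&` dom c)).
    by apply: open_nbhs_nbhs; split => //; exists p.
  near=> y; have [u [[Uu U'u] cu] <-] :
    (fwd c @` ((U `&` U') `&` dom c)) y by near: y.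
  by rewrite /= fwdK//; apply: psiE.
have E2 := derive_scale v (differentiable_crd j df') df.
exists (a * k p + crdo j ('D_v (psi' \o bwd c) (fwd c p))), (k p *: v).
rewrite (psiE p Up U'p).
apply: etrans (congr1 _ (etrans E E2)) _.
rewrite derive_crd; last exact: df'.
rewrite (surf_diffE _ sU Up) -/c.
have -> : 'D_(k p *: v) (psi \o bwd c) (fwd c p) = k p *: 'D_v (psi \o bwd c)
  (fwd c p).
  rewrite !deriveE; [exact: linearZ|exact: df|exact: df].
rewrite scalerDl scalerA /= fwdK// -addrA; congr (_ + _).
by rewrite addrC.
Unshelve. all: by end_near. Qed.

End Lifts.

(** * Existence and uniqueness of [phi_op], and its iterates *)

Section Main.
Context {R : realType} {S : smoothSurface R}.
Implicit Types (phi : S -> quadric R) (op : bool) (U : set S) (j : 'I_8).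
Implicit Types (psi : S -> R44 R) (p u : S) (z : quadric R).

Local Notation e1 := (delta_mx 0 0 : 'rV[R]_2).
Local Notation e2 := (delta_mx 0 1 : 'rV[R]_2).

Lemma surf_diff_lin psi p (a b : R) v w :
  surf_diff psi p (a *: v + b *: w) = a *: surf_diff psi p v + b *: surf_diff
    psi p w.
Proof. by rewrite /surf_diff linearD !linearZ. Qed.

Lemma row2E (v : 'rV[R]_2) : v = v 0 0 *: e1 + v 0 1 *: e2.
Proof.
by apply/rowP => -[[|[|m]]] // i2; rewrite !mxE /= ?mulr1 ?mulr0 ?addr0 ?add0r;
  congr (v _ _); apply: val_inj.
Qed.

Lemma lift_span_frame psi p w : lift_span psi p w <-> exists a b c : R,
  w = a *: psi p + b *: surf_diff psi p e1 + c *: surf_diff psi p e2.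
Proof.
split=> [[a [v ->]]|[a [b [c ->]]]].
  by exists a, (v 0 0), (v 0 1); rewrite {1}(row2E v) surf_diff_lin addrA.
by exists a, (b *: e1 + c *: e2); rewrite surf_diff_lin addrA.
Qed.

(** Coordinate [j] of the lift is constantly 1, so it vanishes on derivatives and isolates the
    coefficient [a]; injectivity of the differential handles [b] and [c]. *)
Lemma immersion_indep phi j U p (psi := affine_chart (lamj j) \o phi) :
  immersion phi -> unit_lift phi j U psi -> U p ->
  in_affine_chart (lamj j) (phi p) ->
  indep3 (psi p) (surf_diff psi p e1) (surf_diff psi p e2).
Proof.
move=> [_ iphi] [[oU sU Upsi] Uj] Up jp a b c abc0.
have [ac cp] := chart_atP p.
have df := surf_smooth_diff sU ac Up cp.
have crd_diff v : crd j (surf_diff psi p v) = 0.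
  rewrite (surf_diffE _ sU Up) -[LHS]/(crdo j _) -derive_crd//.
  rewrite -(derive_cst (1 : R^o) (fwd (chart_at p) p) v).
  apply: near_eq_derive.
  have oO : open (fwd (chart_at p) @` (U `&` dom (chart_at p))) by exact:
    open_fwd.
  have nO : nbhs (fwd (chart_at p) p) (fwd (chart_at p) @` (U `&` dom (chart_at
    p))).
    by apply: open_nbhs_nbhs; split => //; exists p.
  near=> y; have [u [Uu cu] <-] :
    (fwd (chart_at p) @` (U `&` dom (chart_at p))) y by near: y.
  by rewrite /= fwdK//; apply: Uj.
have a0 : a = 0.
  have := congr1 (crd j) abc0; rewrite -addrA crd_linear Uj// mulr1.
  by rewrite -surf_diff_lin crd_diff addr0 -(scale0r (0 : R44 R)) crdZ mul0r.
have bc0 : b *: e1 + c *: e2 = 0.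
  apply: (iphi p (lamj j) jp).
  rewrite -/psi surf_diff_lin [RHS]linear0.
  by move: abc0; rewrite a0 scale0r add0r.
split=> //.
  by have := congr1 (fun v : 'rV_2 => v 0 0) bc0;
    rewrite !mxE /= mulr1 mulr0 addr0.
by have := congr1 (fun v : 'rV_2 => v 0 1) bc0;
  rewrite !mxE /= mulr1 mulr0 add0r.
Unshelve. all: by end_near. Qed.

Lemma span_isotropic phi U psi p x y : totally_isotropic phi ->
  local_lift phi U psi -> U p ->
  lift_span psi p x -> lift_span psi p y -> bf x y = 0.
Proof.
move=> tphi lU Up Vx Vy.
have q0 w : lift_span psi p w -> bf w w = 0.
  by move=> /(tphi U psi lU p Up); rewrite bf_q => ->; rewrite mul0rn.
have Vxy : lift_span psi p (x + y).
  move: Vx Vy => [a [v ->]] [b [w ->]]; exists (a + b), (v + w).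
  have := surf_diff_lin psi p 1 1 v w; rewrite !scale1r => ->.
  by rewrite scalerDl addrACA.
have := q0 _ Vxy; rewrite bfDl [bf x _]bfC [bf y _]bfC !bfDl !q0// add0r addr0.
by rewrite [bf y x]bfC; lra.
Qed.

Lemma span_at_lift phi U psi p : local_lift phi U psi -> U p ->
  lift_span psi p `<=` span_at phi p.
Proof. by move=> lU Up w Vw; exists U, psi. Qed.

Lemma unit_lift_pointP op phi j U psi p z : unit_lift phi j U psi -> U p ->
  is_point op phi p z <-> forall v, v \in val z -> [/\ omul op v (psi p) = 0,
    omul op v (surf_diff psi p e1) = 0 & omul op v (surf_diff psi p e2) = 0].
Proof.
move=> lU Up; split=> [/is_pointP zP v vz|zP].
  have /(_ _ _) V := span_at_lift lU.1 Up.
  split; apply: zP => //; apply: V; apply/lift_span_frame.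
  - by exists 1, 0, 0; rewrite scale1r !scale0r !addr0.
  - by exists 0, 1, 0; rewrite scale1r !scale0r addr0 add0r.
  - by exists 0, 0, 1; rewrite scale1r !scale0r !add0r.
apply/is_pointP => v w vz /(span_at_unit_lift lU Up)/lift_span_frame[a [b [c
  ->]]].
have [v0 v1 v2] := zP v vz.
by rewrite !omulDr !omulZr v0 v1 v2 !scaler0 !addr0.
Qed.

Lemma point_unique op phi p z z' : immersion phi ->
  is_point op phi p z -> is_point op phi p z' -> z = z'.
Proof.
move=> iphi; have [j [U [lU Up jp]]] := exists_unit_lift p iphi.1.
have iV := immersion_indep iphi lU Up jp.
move=> /(unit_lift_pointP _ _ lU Up) zP /(unit_lift_pointP _ _ lU Up) z'P.
have [v0 v1 v2] := zP _ (memv_pick _).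
have [v0' v1' v2'] := z'P _ (memv_pick _).
have [k zz'] := annihilator_unique iV (vpick_neq0 z) v0 v1 v2 v0' v1' v2'.
apply: val_inj; rewrite (quadricE (vpick_neq0 z') (memv_pick _)).
apply: quadricE; first exact: vpick_neq0.
by rewrite zz'; apply: memvZ; exact: memv_pick.
Qed.

(** The default [quadric0] is not reached: the annihilator of the tangent 3-space is a zero divisor,
    hence isotropic, hence spans a point of the quadric. *)
Lemma phi_opP op phi p : immersion phi -> totally_isotropic phi ->
  is_point op phi p (phi_op op phi p).
Proof.
move=> iphi tphi; have [j [U [lU Up jp]]] := exists_unit_lift p iphi.1.
have iV := immersion_indep iphi lU Up jp.
apply: phi_op_point.
move: iV; set psi := affine_chart _ \o _ in lU *.
set x0 := psi p; set x1 := surf_diff psi p e1;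
  set x2 := surf_diff psi p e2 => iV.
have V0 : lift_span psi p x0.
  by apply/lift_span_frame; exists 1, 0, 0; rewrite scale1r !scale0r !addr0.
have V1 : lift_span psi p x1.
  by apply/lift_span_frame; exists 0, 1, 0;
    rewrite scale1r !scale0r addr0 add0r.
have V2 : lift_span psi p x2.
  by apply/lift_span_frame; exists 0, 0, 1; rewrite scale1r !scale0r !add0r.
have b0 x y := @span_isotropic phi U psi p x y tphi lU.1 Up.
have [v [vn0 v0 v1 v2]] := exists_annihilator op iV
  (b0 _ _ V0 V0) (b0 _ _ V1 V1) (b0 _ _ V2 V2)
  (b0 _ _ V0 V1) (b0 _ _ V0 V2) (b0 _ _ V1 V2).
have [z vz] : exists z : quadric R, v \in val z.
  apply: quadric_line => //; apply: (mul_eq0_isotropic v0).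
  by have [_ _ /(_ p Up)[]] := lU.1.
exists z; apply/(unit_lift_pointP _ _ lU Up) => w.
rewrite (quadricE vn0 vz) => /vlineP[k ->].
by rewrite !omulZl v0 v1 v2 !scaler0.
Qed.

Lemma phi_opE op phi p z : immersion phi ->
  is_point op phi p z -> phi_op op phi p = z.
Proof.
move=> iphi zP; apply: (@point_unique op phi p) => //.
by apply: phi_op_point; exists z.
Qed.

Lemma phi_op_incidence op phi U psi c u v : immersion phi ->
  totally_isotropic phi -> local_lift phi U psi -> U u -> atlas S c -> dom c u
    ->
  v \in val (phi_op op phi u) ->
  omul op v (psi u) = 0 /\
  forall w, omul op v ('D_w (psi \o bwd c) (fwd c u)) = 0.
Proof.
move=> iphi tphi lU Uu ac cu vz.
have /is_pointP uP := @phi_opP op phi u iphi tphi.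
split=> [|w]; apply: uP => //; apply: (span_at_lift lU Uu).
  by apply/lift_span_frame; exists 1, 0, 0; rewrite scale1r !scale0r !addr0.
by case: lU => oU sU _; exact: derive_lift_span oU sU ac Uu cu.
Qed.

Lemma phi_op_op op phi p : immersion phi -> totally_isotropic phi ->
  immersion (phi_op op phi) ->
  is_point op (phi_op op phi) p (phi_op (~~ op) phi p) /\
  is_point (~~ op) (phi_op op phi) p (phi p).
Proof.
move=> iphi tphi iphi'.
have [j [U [lU Up jp]]] := exists_unit_lift p iphi.1.
have [j' [U' [lU' U'p jp']]] := exists_unit_lift p iphi'.1.
have iV := immersion_indep iphi lU Up jp.
set psi := affine_chart (lamj j) \o phi in lU iV.
set psi' := affine_chart (lamj j') \o _ in lU'.
have [[oU sU Upsi] _] := lU; have [[oU' sU' Upsi'] _] := lU'.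
have [ac cp] := chart_atP p.
have db := fun w => surf_diffE w sU Up.
have db' := fun w => surf_diffE w sU' U'p.
set c := chart_at p in ac cp db db'.
set x := fwd c p in db db'.
set f := psi \o bwd c in db *; set g := psi' \o bwd c in db' *.
have df : differentiable f x := surf_smooth_diff sU ac Up cp.
have dg : differentiable g x := surf_smooth_diff sU' ac U'p cp.
have fx : f x = psi p by rewrite /f /x /= fwdK.
have gx : g x = psi' p by rewrite /g /x /= fwdK.
pose O := fwd c @` ((U `&` U') `&` dom c).
have oO : open O by exact/open_fwd/openI.
have Ox : O x by exists p.
have nO : nbhs x O by exact: open_nbhs_nbhs.
have dvf w : differentiable ('D_w f) x.
  have [_ /(_ w)[dvf _]] := sU c ac 2%N; apply: dvf.
  by exists p.
(* These relations hold on a whole neighbourhood of [x] in one chart, so they may be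
   differentiated. *)
have gf0 y : O y -> omul op (g y) (f y) = 0 /\
    forall w, omul op (g y) ('D_w f y) = 0.
  move=> [u [[Uu U'u] cu] <-].
  have [_ gu] := Upsi' u U'u.
  have [E0 E1] := phi_op_incidence iphi tphi lU.1 Uu ac cu gu.
  by rewrite /g /f /= fwdK.
have [gf gdf] := gf0 x Ox.
have dgf w : omul op ('D_w g x) (f x) = 0.
  have := derive_omul op w dg df; rewrite gdf add0r => <-.
  rewrite -(derive_cst (0 : R44 R) x w); apply: near_eq_derive.
  by near=> y; have [|] := gf0 y; first by near: y.
have dgdf w w' : omul op ('D_w' g x) ('D_w f x) =
    - omul op (g x) ('D_w' ('D_w f) x).
  apply/eqP; rewrite -addr_eq0 addrC -derive_omul//; apply/eqP.
  rewrite -(derive_cst (0 : R44 R) x w'); apply: near_eq_derive.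
  by near=> y; have [|_] := gf0 y; first by near: y.
have sym w w' : 'D_w' ('D_w f) x = 'D_w ('D_w' f) x.
  apply: (schwarz44 (U := fwd c @` (U `&` dom c))).
  - exact: open_fwd.
  - by exists p.
  - exact: sU.
(* The claim about [phi p] comes first: it only reverses the products [gf] and [dgf]. *)
split; apply/(unit_lift_pointP _ _ lU' U'p) => v vz; rewrite !db' -gx;
  last first.
  have [f0 fl] := Upsi p Up.
  move: vz; rewrite (quadricE f0 fl) => /vlineP[k ->].
  have swap0 (a b : R44 R) : omul op a b = 0 -> omul (~~ op) (k *: b) a = 0.
    by rewrite omulZl (omulC op) => ->; rewrite scaler0.
  rewrite -fx.
  by split; [exact: swap0 gf|exact: swap0 (dgf e1)|exact: swap0 (dgf e2)].
have [vf vdf] := phi_op_incidence iphi tphi lU.1 Up ac cp vz.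
(* [v] annihilates from the side opposite to [g], hence stands on the right in the product [op]. *)
have fv : omul op (f x) v = 0 by rewrite (omulC op) fx; exact: vf.
have dfv w : omul op ('D_w f x) v = 0 by rewrite (omulC op); exact: vdf.
move: iV; rewrite !db -fx => iV.
have V w : lift_span psi p ('D_w f x) := derive_lift_span w oU sU ac Up cp.
have V0 : lift_span psi p (f x).
  by rewrite fx; apply/lift_span_frame; exists 1, 0, 0;
    rewrite scale1r !scale0r !addr0.
have b0 w w' := @span_isotropic phi U psi p w w' tphi lU.1 Up.
have vg : omul op v (g x) = 0.
  apply: (incident_ortho (u := f x) (v := 'D_e1 f x)) => //.
  - move=> k l kl; have [|k0 l0 _] := iV k l 0; last by [].
    by rewrite kl scale0r addr0.
  - exact: b0.
  - exact: b0.
(* The remaining premise, equality of the mixed products, follows from [dgdf] and the symmetry of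
   the second derivative of [f]. *)
have [|vd1 vd2] := mixed_symmetry iV (b0 _ _ V0 V0) (b0 _ _ V0 (V _))
  (b0 _ _ V0 (V _)) fv (dfv _) (dfv _) (dgf e1) (dgf e2).
  apply: etrans (dgdf e2 e1) (etrans _ (esym (dgdf e1 e2))).
  exact: (congr1 (fun y => - omul op (g x) y) (sym e2 e1)).
by [].
Unshelve. all: by end_near. Qed.

End Main.

Theorem proposition10 (R : realType) (S : smoothSurface R)
    (phi : S -> quadric R) (phi_immersion : immersion phi)
    (phi_isotropic : totally_isotropic phi) :
  (immersion (phi_plus phi) ->
     phi_plus (phi_plus phi) = phi_minus phi /\
     phi_minus (phi_plus phi) = phi) /\
  (immersion (phi_minus phi) ->
     phi_minus (phi_minus phi) = phi_plus phi /\
     phi_plus (phi_minus phi) = phi).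
Proof.
(* The values [false] and [true] of [op] give the two halves; each equality is pointwise uniqueness
   for the immersion [phi_op op phi]. *)
have main op : immersion (phi_op op phi) ->
    phi_op op (phi_op op phi) = phi_op (~~ op) phi /\
    phi_op (~~ op) (phi_op op phi) = phi.
  by move=> iphi'; split; apply/funext => p; apply: phi_opE => //;
    have [] := phi_op_op p phi_immersion phi_isotropic iphi'.
by split; [exact: (main false)|exact: (main true)].
Qed.
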